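(* Let $f:(0,\infty)\to\mathbb{R}$ be a convex function with $f(1)=0$. Let $\mathbf{p}=\{p_1,\dots,p_n\}$ and $\mathbf{r}=\{r_1,\dots,r_n\}$ be two probability distributions with $p_j>0$, $r_j>0$ for all $j$, and let $\mathbf{t}=\{t_1,\dots,t_n\}$ with $t_j=\frac{p_j^2}{r_j}$. Then $$0\leq \min_{1\leq i\leq n}\left\{\frac{r_i}{p_i}\right\}\left(\widetilde{D_{f^*}}(\mathbf{t}\|\mathbf{p})-f\left(\sum_{j=1}^n t_j\right)\right)\leq D_f(\mathbf{p}\|\mathbf{r})\leq \max_{1\leq i\leq n}\left\{\frac{r_i}{p_i}\right\}\left(\widetilde{D_{f^*}}(\mathbf{t}\|\mathbf{p})-f\left(\sum_{j=1}^n t_j\right)\right).$$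
   Context: For a convex function $f$ on $(0,\infty)$ with $f(1)=0$, the Csiszár $f$-divergence of positive probability distributions is $D_f(\mathbf{p}\|\mathbf{r})=\sum_{j=1}^n r_jf\left(\frac{p_j}{r_j}\right)$. The dual function is $f^*(t)=tf\left(\frac1t\right)$ for $t>0$. For vectors $\{a_1,\dots,a_n\}$, $\{b_1,\dots,b_n\}$ with positive entries (not necessarily summing to $1$), $$\widetilde{D_{f^*}}(a_1,\dots,a_n\|b_1,\dots,b_n)=\sum_{j=1}^n a_jf^*\left(\frac{b_j}{a_j}\right).$$ *)

(* Defs.v *)
From HB Require Import structures.
From mathcomp Require Import all_boot all_order all_algebra.
From mathcomp Require Import classical_sets set_interval reals convex.

Set Implicit Arguments.
Unset Strict Implicit.
Unset Printing Implicit Defensive.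

Import Order.TTheory GRing.Theory Num.Theory.
Local Open Scope ring_scope.

(* A function on (0, +oo) is represented by a total f : R -> R whose values
   outside (0, +oo) are irrelevant: with positive arguments, every definition
   below evaluates f at positive points only. *)

Definition f_divergence (R : realType) (n : nat) (f : R -> R)
    (p r : 'I_n -> R) : R :=
  \sum_(j < n) r j * f (p j / r j).

Definition dual_fun (R : realType) (f : R -> R) (t : R) : R := t * f (1 / t).

(* D~_{f^*}(a || b), for positive vectors not necessarily summing to 1; f is the
   original function and its dual is taken inside. *)
Definition dual_divergence (R : realType) (n : nat) (f : R -> R)
    (a b : 'I_n -> R) : R :=
  \sum_(j < n) a j * dual_fun f (b j / a j).

Definition is_positive_distribution (R : realType) (n : nat)
    (p : 'I_n -> R) : Prop :=
  (forall j, 0 < p j) /\ \sum_(j < n) p j = 1.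

(* Over a nonempty index type, starting the iteration from a value of the
   family makes the result the genuine minimum, resp. maximum. *)
Definition min_family (R : realType) (n : nat) (F : 'I_n.+1 -> R) : R :=
  \big[Num.min/F ord0]_(i < n.+1) F i.

Definition max_family (R : realType) (n : nat) (F : 'I_n.+1 -> R) : R :=
  \big[Num.max/F ord0]_(i < n.+1) F i.

(* Main.v *)
Require Import Defs.
From HB Require Import structures.
From mathcomp Require Import all_boot all_order all_algebra.
From mathcomp Require Import classical_sets set_interval reals convex.
From mathcomp Require Import interval_inference ring lra.

(** Put [x j = p j / r j].  Then [D~_{f^*}(t || p) - f (\sum t)] is the Jensen
    gap [J_p = \sum_j p j * f (x j) - f (\sum_j p j * x j)], while [D_f(p || r)]
    is the Jensen gap [J_r] with weights [r], because [\sum_j r j * x j = 1] and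
    [f 1 = 0].  If [m * p j <= r j] for all [j], then [m * J_p <= J_r]: this is
    Jensen's inequality for the points [x j] with weights [r j - m * p j]
    together with the extra point [\sum_j p j * x j] of weight [m].  Taking for
    [m] the minimum of [r j / p j] gives the lower bound; exchanging [p] and [r]
    and taking the inverse of the maximum gives the upper bound. *)

Set Implicit Arguments.
Unset Strict Implicit.
Unset Printing Implicit Defensive.

Import Order.TTheory GRing.Theory Num.Theory.
Local Open Scope ring_scope.

(** Convexity at the weights [a / (a + b)] and [b / (a + b)], multiplied through by [a + b], so that
    weights need not be normalised. *)
Lemma convex_function_weight2 (R : realType) (f : R -> R) (a b x y : R) :
  @convex_function R R^o `]0, +oo[%classic f ->
  0 < a -> 0 <= b -> 0 < x -> 0 < y ->
  (a + b) * f ((a * x + b * y) / (a + b)) <= a * f x + b * f y.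
Proof.
move=> cf a0 b0 x0 y0.
have ab0 : 0 < a + b by rewrite ltr_wpDr.
have k0 : 0 <= a / (a + b) by rewrite divr_ge0 ?ltW.
have k1 : a / (a + b) <= 1 by rewrite ler_pdivrMr// mul1r lerDl.
have cfxy : f (a / (a + b) * x + (1 - a / (a + b)) * y) <=
    a / (a + b) * f x + (1 - a / (a + b)) * f y.
  by apply: (cf (Itv01 k0 k1)); rewrite inE /= in_itv /= ?x0 ?y0.
have -> : (a * x + b * y) / (a + b) =
    a / (a + b) * x + (1 - a / (a + b)) * y by field; rewrite gt_eqF.
move: cfxy; rewrite -(ler_pM2l ab0) => /le_trans; apply.
by rewrite le_eqVlt; apply/orP; left; apply/eqP; field; rewrite gt_eqF.
Qed.

(* Singling out a point of positive weight keeps the total weight nonzero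
   throughout the induction. *)
Lemma jensen_pointed (R : realType) (f : R -> R) (I : Type) (s : seq I)
    (w x : I -> R) (a y : R) :
  @convex_function R R^o `]0, +oo[%classic f ->
  (forall i, 0 <= w i) -> (forall i, 0 < x i) -> 0 < a -> 0 < y ->
  (a + \sum_(i <- s) w i) *
    f ((a * y + \sum_(i <- s) w i * x i) / (a + \sum_(i <- s) w i))
  <= a * f y + \sum_(i <- s) w i * f (x i).
Proof.
move=> cf w0 x0; elim: s a y => [|i s IHs] a y a0 y0.
  by rewrite !big_nil !addr0 mulrAC divff ?gt_eqF// mul1r.
rewrite !big_cons !addrA.
have aw0 : 0 < a + w i by rewrite ltr_wpDr.
(* Merge the singled-out point and the head into their weighted mean, of weight [a + w i]; it is the
   singled-out point for the tail. *)
have z0 : 0 < (a * y + w i * x i) / (a + w i).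
  by rewrite divr_gt0// ltr_wpDr ?mulr_gt0// mulr_ge0// ltW.
have := IHs _ _ aw0 z0.
rewrite [(a + w i) * (_ / _)]mulrC divfK ?gt_eqF// => /le_trans; apply.
by rewrite lerD2r convex_function_weight2.
Qed.

Definition jensen_gap (R : realType) (n : nat) (f : R -> R)
    (p x : 'I_n -> R) : R :=
  \sum_(j < n) p j * f (x j) - f (\sum_(j < n) p j * x j).

Lemma positive_distribution_mean_gt0 (R : realType) (n : nat)
    (p x : 'I_n -> R) :
  is_positive_distribution p -> (forall j, 0 < x j) ->
  0 < \sum_(j < n) p j * x j.
Proof.
move=> [p0]; case: n => [|n] in p x p0 *.
  by rewrite big_ord0 => /esym/eqP; rewrite oner_eq0.
move=> _ x0; rewrite big_ord_recl ltr_wpDr ?mulr_gt0//.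
by apply: sumr_ge0 => i _; rewrite ltW ?mulr_gt0.
Qed.

Lemma jensen_gap_ge0 (R : realType) (n : nat) (f : R -> R) (p x : 'I_n -> R) :
  @convex_function R R^o `]0, +oo[%classic f ->
  is_positive_distribution p -> (forall j, 0 < x j) ->
  0 <= jensen_gap f p x.
Proof.
move=> cf pd x0; have y0 := positive_distribution_mean_gt0 pd x0.
have [p0 p1] := pd.
(* Single out the mean itself, with weight 1: the total weight is 2 and the overall mean is
   unchanged, so one copy of its value cancels. *)
have := jensen_pointed (index_enum 'I_n) cf (fun i => ltW (p0 i)) x0 ltr01 y0.
rewrite /jensen_gap p1.
set y := \sum_(i < n) p i * x i.
have -> : (1 * y + y) / (1 + 1) = y by field.
lra.
Qed.

Lemma jensen_gap_le (R : realType) (n : nat) (f : R -> R) (m : R)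
    (p r x : 'I_n -> R) :
  @convex_function R R^o `]0, +oo[%classic f ->
  is_positive_distribution p -> is_positive_distribution r ->
  (forall j, 0 < x j) -> 0 < m -> (forall j, m * p j <= r j) ->
  m * jensen_gap f p x <= jensen_gap f r x.
Proof.
move=> cf pd rd x0 m0 mpr; have y0 := positive_distribution_mean_gt0 pd x0.
have [[_ p1] [_ r1]] := (pd, rd).
have w0 j : 0 <= r j - m * p j by rewrite subr_ge0.
have wE (g : 'I_n -> R) : \sum_j (r j - m * p j) * g j =
    \sum_j r j * g j - m * \sum_j p j * g j.
  rewrite mulr_sumr -sumrB; apply: eq_bigr => j _; ring.
have := jensen_pointed (index_enum 'I_n) cf w0 x0 m0 y0.
(* The total weight is [m + (1 - m) = 1], and the contributions of [m] to the overall mean cancel,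
   leaving the mean for [r]. *)
rewrite !wE sumrB -mulr_sumr p1 r1 mulr1 !subrKC divr1 mul1r /jensen_gap.
lra.
Qed.

Theorem theorem3p5 (R : realType) (n : nat) (f : R -> R)
    (f_convex : @convex_function R R^o `]0, +oo[%classic f)
    (f1 : f 1 = 0)
    (p r t : 'I_n.+1 -> R)
    (p_distr : is_positive_distribution p)
    (r_distr : is_positive_distribution r)
    (tE : forall j, t j = p j ^+ 2 / r j) :
  [/\ 0 <= min_family (fun i => r i / p i) *
             (dual_divergence f t p - f (\sum_(j < n.+1) t j)),
      min_family (fun i => r i / p i) *
        (dual_divergence f t p - f (\sum_(j < n.+1) t j))
        <= f_divergence f p r
    & f_divergence f p r
        <= max_family (fun i => r i / p i) *
             (dual_divergence f t p - f (\sum_(j < n.+1) t j))].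
Proof.
have [[p0 p1] [r0 r1]] := (p_distr, r_distr).
pose x j := p j / r j.
have x0 j : 0 < x j by rewrite divr_gt0.
have -> : dual_divergence f t p - f (\sum_j t j) = jensen_gap f p x.
  (* Termwise, [t j * (p j / t j) = p j] and [t j / p j = x j]. *)
  rewrite /jensen_gap; congr (_ - f _); apply: eq_bigr => j _.
    rewrite /dual_fun mulrA tE /x.
    by congr (_ * f _); field; rewrite !gt_eqF.
  by rewrite tE expr2 -mulrA.
have -> : f_divergence f p r = jensen_gap f r x.
  rewrite /jensen_gap [X in f X](_ : _ = 1) ?f1 ?subr0// -p1.
  by apply: eq_bigr => j _; rewrite mulrC divfK ?gt_eqF.
have m0 : 0 < min_family (fun i => r i / p i).
  by apply: lt_bigmin => [|i _]; rewrite divr_gt0.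
have M0 : 0 < max_family (fun i => r i / p i).
  apply: lt_le_trans (le_bigmax _ _ ord0); exact: divr_gt0.
split.
- by rewrite mulr_ge0 ?jensen_gap_ge0// ltW.
- apply: jensen_gap_le => // j.
  by rewrite -ler_pdivlMr//; apply: bigmin_le.
(* With [M] the maximum, [r j / p j <= M] reads [M^-1 * r j <= p j]. *)
- rewrite -ler_pdivrMl//; apply: jensen_gap_le => //; first by rewrite invr_gt0.
  by move=> j; rewrite ler_pdivrMl// -ler_pdivrMr//; apply: le_bigmax.
Qed.
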